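(* Let $r$ be a nonnegative integer and $\lambda\in\mathbb{C}$ with $\lambda\ne1$. For every integer $n\ge 0$, \[ H_n(x)=\frac{1}{(1-\lambda)^r}\sum_{k=0}^{n}\binom{n}{k}2^k\left[\sum_{j=0}^{r}\binom{r}{j}(-\lambda)^{r-j}H_{n-k}(j)\right]H_k^{(r)}(x\mid\lambda). \]
   Context: The Hermite polynomials $H_n(x)$ are defined by $e^{2xt-t^2}=\sum_{n\ge0}H_n(x)\frac{t^n}{n!}$. For $\lambda\in\mathbb{C}$, $\lambda\ne1$, the Frobenius–Euler polynomials of order $r$ are defined by $\left(\frac{1-\lambda}{e^t-\lambda}\right)^r e^{xt}=\sum_{n\ge0}H_n^{(r)}(x\mid\lambda)\frac{t^n}{n!}$ (these are distinct from the Hermite polynomials $H_n(x)$). *)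

(* Defs.v *)
From HB Require Import structures.
From mathcomp Require Import all_boot all_order all_algebra.
From mathcomp Require Import boolp reals.
From mathcomp Require Export complex.

Set Implicit Arguments.
Unset Strict Implicit.
Unset Printing Implicit Defensive.

Import Order.TTheory GRing.Theory Num.Theory.
Local Open Scope ring_scope.

(* A wrapper around nat -> A: the bare function type would carry the pointwise
   product instead of the Cauchy product. *)
Record fps (A : Type) := Fps { fps_coef : nat -> A }.

Lemma fpsP (A : Type) (f g : fps A) : fps_coef f =1 fps_coef g -> f = g.
Proof. by case: f g => [f] [g] /= /funext ->. Qed.

HB.instance Definition _ (A : Type) := gen_eqMixin (fps A).
HB.instance Definition _ (A : Type) := gen_choiceMixin (fps A).

Definition fps_zero (A : comUnitRingType) : fps A := Fps (fun=> 0).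
Definition fps_opp (A : comUnitRingType) (f : fps A) : fps A :=
  Fps (fun n => - fps_coef f n).
Definition fps_add (A : comUnitRingType) (f g : fps A) : fps A :=
  Fps (fun n => fps_coef f n + fps_coef g n).

Fact fps_addA (A : comUnitRingType) : associative (@fps_add A).
Proof. by move=> f g h; apply/fpsP => n /=; rewrite addrA. Qed.
Fact fps_addC (A : comUnitRingType) : commutative (@fps_add A).
Proof. by move=> f g; apply/fpsP => n /=; rewrite addrC. Qed.
Fact fps_add0 (A : comUnitRingType) : left_id (fps_zero A) (@fps_add A).
Proof. by move=> f; apply/fpsP => n /=; rewrite add0r. Qed.
Fact fps_addN (A : comUnitRingType) :
  left_inverse (fps_zero A) (@fps_opp A) (@fps_add A).
Proof. by move=> f; apply/fpsP => n /=; rewrite addNr. Qed.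

HB.instance Definition _ (A : comUnitRingType) :=
  GRing.isZmodule.Build (fps A)
    (@fps_addA A) (@fps_addC A) (@fps_add0 A) (@fps_addN A).

Definition fpsC (A : comUnitRingType) (a : A) : fps A :=
  Fps (fun n => if n == 0%N then a else 0).
Definition fpsX (A : comUnitRingType) : fps A := Fps (fun n => (n == 1%N)%:R).
Definition fps_mul (A : comUnitRingType) (f g : fps A) : fps A :=
  Fps (fun n => \sum_(i < n.+1) fps_coef f i * fps_coef g (n - i)).

Fact fps_mul_rev (A : comUnitRingType) (f g : fps A) n :
  fps_coef (fps_mul f g) n = \sum_(i < n.+1) fps_coef f (n - i) * fps_coef g i.
Proof.
rewrite /= (reindex_inj rev_ord_inj) /=.
by apply: eq_bigr => j _; rewrite (sub_ordK j).
Qed.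

Fact fps_mulC (A : comUnitRingType) : commutative (@fps_mul A).
Proof.
move=> f g; apply/fpsP => n; rewrite fps_mul_rev /=.
by apply: eq_bigr => i _; rewrite mulrC.
Qed.

Fact fps_mulA (A : comUnitRingType) : associative (@fps_mul A).
Proof.
move=> f g h; apply/fpsP=> i; rewrite [RHS]fps_mul_rev.
pose coef3 j k := fps_coef f j * (fps_coef g (i - j - k)%N * fps_coef h k).
transitivity (\sum_(j < i.+1) \sum_(k < i.+1 | (k <= i - j)%N) coef3 j k).
  rewrite [LHS]/=; apply: eq_bigr => j _.
  rewrite -[X in _ * X]/(fps_coef (fps_mul g h) (i - j)) fps_mul_rev.
  by rewrite big_distrr /= (big_ord_narrow_leq (leq_subr _ _)).
rewrite (exchange_big_dep predT) //=; apply: eq_bigr => k _.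
transitivity (\sum_(j < i.+1 | (j <= i - k)%N) coef3 j k).
  apply: eq_bigl => j; rewrite -ltnS -(ltnS j) -!subSn ?leq_ord //.
  by rewrite -subn_gt0 -(subn_gt0 j) -!subnDA addnC.
rewrite [RHS]big_distrl (big_ord_narrow_leq (leq_subr _ _)) /=.
by apply: eq_bigr => j _; rewrite /coef3 -!subnDA addnC mulrA.
Qed.

Fact fps_mul1 (A : comUnitRingType) : left_id (fpsC (1 : A)) (@fps_mul A).
Proof.
move=> f; apply/fpsP => n /=; rewrite big_ord_recl /= mul1r subn0.
by rewrite big1 ?addr0 // => i _; rewrite mul0r.
Qed.

Fact fps_mulDl (A : comUnitRingType) : left_distributive (@fps_mul A) +%R.
Proof.
move=> f g h; apply/fpsP => n /=; rewrite -big_split.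
by apply: eq_bigr => i _; rewrite mulrDl.
Qed.

Fact fps_1neq0 (A : comUnitRingType) : fpsC (1 : A) != 0.
Proof.
by apply/eqP => /(congr1 (fun f => fps_coef f 0)) /eqP; rewrite oner_eq0.
Qed.

HB.instance Definition _ (A : comUnitRingType) :=
  GRing.Zmodule_isComNzRing.Build (fps A)
    (@fps_mulA A) (@fps_mulC A) (@fps_mul1 A) (@fps_mulDl A) (@fps_1neq0 A).

(* [fps_inv_seq f n] lists the first [n] coefficients of 1 / f, obtained by
   solving g * f = 1 for one coefficient of g after the other. *)
Fixpoint fps_inv_seq (A : comUnitRingType) (f : fps A) (n : nat) : seq A :=
  if n is m.+1 then
    let s := fps_inv_seq f m in
    rcons s ((fps_coef f 0)^-1 *
             ((m == 0%N)%:R - \sum_(j < m) s`_j * fps_coef f (m - j)))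
  else [::].

Definition fps_unit (A : comUnitRingType) : {pred fps A} :=
  fun f => fps_coef f 0 \is a GRing.unit.
Definition fps_inv (A : comUnitRingType) (f : fps A) : fps A :=
  if fps_coef f 0 \is a GRing.unit then Fps (fun n => (fps_inv_seq f n.+1)`_n)
  else f.

Lemma size_fps_inv_seq (A : comUnitRingType) (f : fps A) n :
  size (fps_inv_seq f n) = n.
Proof. by elim: n => //= n IH; rewrite size_rcons IH. Qed.

Lemma nth_fps_inv_seq (A : comUnitRingType) (f : fps A) n i :
  (i < n)%N -> (fps_inv_seq f n)`_i = (fps_inv_seq f i.+1)`_i.
Proof.
elim: n => // n IH; rewrite ltnS leq_eqVlt => /predU1P [-> //|lt_in].
by rewrite [in LHS]/= nth_rcons size_fps_inv_seq lt_in IH.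
Qed.

Fact fps_mulV (A : comUnitRingType) :
  {in @fps_unit A, left_inverse 1 (@fps_inv A) *%R}.
Proof.
move=> f; rewrite unfold_in => uf; rewrite /fps_inv uf; apply/fpsP => n.
rewrite [LHS]/= big_ord_recr [X in _ + X]/= subnn nth_rcons size_fps_inv_seq.
rewrite ltnn eqxx mulrAC mulVr // mul1r [LHS]addrC.
have -> : fps_coef (1 : fps A) n = (n == 0%N)%:R by case: n.
rewrite -[RHS](subrK (\sum_(j < n) (fps_inv_seq f n)`_j * fps_coef f (n - j))).
congr (_ + _); apply: eq_bigr => i _.
by rewrite [in RHS](nth_fps_inv_seq _ (ltn_ord i)).
Qed.

Fact fps_unitPl (A : comUnitRingType) (f g : fps A) :
  g * f = 1 -> fps_unit f.
Proof.
move=> /(congr1 (fun h => fps_coef h 0)); rewrite /= big_ord1 subnn => gf1.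
by rewrite /fps_unit; apply/unitrPr; exists (fps_coef g 0); rewrite mulrC.
Qed.

Fact fps_inv_out (A : comUnitRingType) :
  {in [predC @fps_unit A], @fps_inv A =1 id}.
Proof. by move=> f; rewrite inE unfold_in /fps_inv => /negbTE ->. Qed.

HB.instance Definition _ (A : comUnitRingType) :=
  GRing.ComNzRing_hasMulInverse.Build (fps A)
    (@fps_mulV A) (@fps_unitPl A) (@fps_inv_out A).

(* exp(f) = \sum_m f^m / m!, meaningful when f has zero constant term and A has
   characteristic zero: f^m then starts at degree m, so that only the terms with
   m <= n contribute to the coefficient of degree n. *)
Definition fps_exp (A : comUnitRingType) (f : fps A) : fps A :=
  Fps (fun n => \sum_(m < n.+1) fps_coef (f ^+ m) n / m`!%:R).

(* In the generating functions below, fpsX is the variable t, and the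
   coefficient ring is {poly F}, whose indeterminate 'X is the variable x. *)

Definition hermite_gf (F : numFieldType) : fps {poly F} :=
  fps_exp (fpsC ('X *+ 2) * fpsX _ - fpsX _ ^+ 2).

Definition hermite (F : numFieldType) (n : nat) : {poly F} :=
  fps_coef (hermite_gf F) n *+ n`!.

Definition frobenius_euler_gf (F : numFieldType) (r : nat) (lambda : F) :
    fps {poly F} :=
  (fpsC (1 - lambda)%:P / (fps_exp (fpsX _) - fpsC lambda%:P)) ^+ r
  * fps_exp (fpsC 'X * fpsX _).

Definition frobenius_euler (F : numFieldType) (r : nat) (lambda : F) (n : nat) :
    {poly F} :=
  fps_coef (frobenius_euler_gf r lambda) n *+ n`!.

Lemma fact_poly_unit (F : numFieldType) n :
  (n`!%:R : {poly F}) \is a GRing.unit.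
Proof.
rewrite -polyC_natr poly_unitE size_polyC coefC /= unitfE pnatr_eq0.
by rewrite -lt0n fact_gt0.
Qed.

Lemma hermite_gfE (F : numFieldType) :
  Fps (fun n => hermite F n / n`!%:R) = hermite_gf F.
Proof.
apply/fpsP => n; rewrite /hermite [LHS]/= -[X in X / _]mulr_natr.
by rewrite mulrK ?fact_poly_unit.
Qed.

Lemma frobenius_euler_gfE (F : numFieldType) r (lambda : F) :
  Fps (fun n => frobenius_euler r lambda n / n`!%:R)
  = frobenius_euler_gf r lambda.
Proof.
apply/fpsP => n; rewrite /frobenius_euler [LHS]/= -[X in X / _]mulr_natr.
by rewrite mulrK ?fact_poly_unit.
Qed.

Lemma exp_sub_unit (F : numFieldType) (lambda : F) : lambda != 1 ->
  fps_exp (fpsX {poly F}) - fpsC lambda%:P \is a GRing.unit.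
Proof.
rewrite eq_sym -subr_eq0 => l1.
rewrite unfold_in /= /fps_unit /= big_ord1 expr0 /= divr1 -polyCB.
by rewrite poly_unitE size_polyC l1 coefC eqxx unitfE l1.
Qed.

(* Main.v *)
(* Multiply and divide e^{2xt - t^2} by
   ((e^{2t} - lambda) / (1 - lambda))^r.  The factor
   ((1 - lambda) / (e^{2t} - lambda))^r e^{2xt} is the Frobenius-Euler generating
   function at 2t, while expanding (e^{2t} - lambda)^r e^{-t^2} by the binomial
   theorem gives a combination of the series e^{2jt - t^2}, which are the Hermite
   generating functions at x = j.  Then compare coefficients of t^n. *)
From HB Require Import structures.
Require Import Defs.
From mathcomp Require Import all_boot all_order all_algebra.
From mathcomp Require Import reals.

Set Implicit Arguments.
Unset Strict Implicit.
Unset Printing Implicit Defensive.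

Import GRing.Theory Num.Theory.
Local Open Scope ring_scope.

(** * Coefficients and ring morphisms of power series *)

Lemma fps_coefM (A : comUnitRingType) (f g : fps A) n :
  fps_coef (f * g) n = \sum_(i < n.+1) fps_coef f i * fps_coef g (n - i).
Proof. by []. Qed.

Lemma fps_coef_sum (A : comUnitRingType) (I : Type) (s : seq I) (P : pred I)
    (F : I -> fps A) n :
  fps_coef (\sum_(i <- s | P i) F i) n = \sum_(i <- s | P i) fps_coef (F i) n.
Proof. by elim/big_rec2: _ => //= i x y _ <-. Qed.

Lemma fps_coefMn (A : comUnitRingType) (f : fps A) m n :
  fps_coef (f *+ m) n = fps_coef f n *+ m.
Proof. by elim: m => [|m IH] //; rewrite !mulrS -IH. Qed.

Lemma fps_coefCM (A : comUnitRingType) (a : A) (f : fps A) n :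
  fps_coef (fpsC a * f) n = a * fps_coef f n.
Proof.
rewrite fps_coefM big_ord_recl /= subn0 big1 ?addr0 // => i _.
by rewrite mul0r.
Qed.

Fact fpsC_zmod_morphism (A : comUnitRingType) : zmod_morphism (@fpsC A).
Proof. by move=> a b; apply/fpsP => -[|n] //=; rewrite subr0. Qed.
Fact fpsC_monoid_morphism (A : comUnitRingType) : monoid_morphism (@fpsC A).
Proof.
split=> // a b; apply/fpsP => n; rewrite fps_coefCM /=.
by case: eqP => // _; rewrite mulr0.
Qed.
HB.instance Definition _ (A : comUnitRingType) :=
  GRing.isZmodMorphism.Build A (fps A) (@fpsC A) (@fpsC_zmod_morphism A).
HB.instance Definition _ (A : comUnitRingType) :=
  GRing.isMonoidMorphism.Build A (fps A) (@fpsC A) (@fpsC_monoid_morphism A).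

(** Used with [polyC \o horner_eval a], this specializes x to the scalar a; composing with [polyC]
    keeps the coefficients in [{poly F}], so that the result can be multiplied with series still
    containing x. *)
Definition fps_map (A B : comUnitRingType) (phi : A -> B) (f : fps A) : fps B :=
  Fps (fun n => phi (fps_coef f n)).

Fact fps_map_zmod_morphism (A B : comUnitRingType) (phi : {rmorphism A -> B}) :
  zmod_morphism (fps_map phi).
Proof. by move=> f g; apply/fpsP => n /=; rewrite rmorphB. Qed.
Fact fps_map_monoid_morphism (A B : comUnitRingType) (phi : {rmorphism A -> B}) :
  monoid_morphism (fps_map phi).
Proof.
split=> [|f g]; apply/fpsP => n /=.
  by rewrite (fun_if phi) rmorph1 rmorph0.
by rewrite rmorph_sum; apply: eq_bigr => i _; rewrite rmorphM.
Qed.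
HB.instance Definition _ (A B : comUnitRingType) (phi : {rmorphism A -> B}) :=
  GRing.isZmodMorphism.Build (fps A) (fps B) (fps_map phi)
    (fps_map_zmod_morphism phi).
HB.instance Definition _ (A B : comUnitRingType) (phi : {rmorphism A -> B}) :=
  GRing.isMonoidMorphism.Build (fps A) (fps B) (fps_map phi)
    (fps_map_monoid_morphism phi).

Lemma fps_mapC (A B : comUnitRingType) (phi : {rmorphism A -> B}) a :
  fps_map phi (fpsC a) = fpsC (phi a).
Proof. by apply/fpsP => n /=; rewrite (fun_if phi) rmorph0. Qed.

Lemma fps_mapX (A B : comUnitRingType) (phi : {rmorphism A -> B}) :
  fps_map phi (fpsX A) = fpsX B.
Proof. by apply/fpsP => n /=; rewrite rmorph_nat. Qed.

(* The substitution of c t for the variable t. *)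
Definition fps_scale (A : comUnitRingType) (c : A) (f : fps A) : fps A :=
  Fps (fun n => c ^+ n * fps_coef f n).

Fact fps_scale_zmod_morphism (A : comUnitRingType) (c : A) :
  zmod_morphism (fps_scale c).
Proof. by move=> f g; apply/fpsP => n /=; rewrite mulrBr. Qed.
Fact fps_scale_monoid_morphism (A : comUnitRingType) (c : A) :
  monoid_morphism (fps_scale c).
Proof.
split=> [|f g]; apply/fpsP => n /=.
  by case: eqP => [->|_]; rewrite ?mulr1 ?mulr0.
rewrite mulr_sumr; apply: eq_bigr => i _.
by rewrite mulrACA -exprD subnKC // -ltnS.
Qed.
HB.instance Definition _ (A : comUnitRingType) (c : A) :=
  GRing.isZmodMorphism.Build (fps A) (fps A) (fps_scale c)
    (fps_scale_zmod_morphism c).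
HB.instance Definition _ (A : comUnitRingType) (c : A) :=
  GRing.isMonoidMorphism.Build (fps A) (fps A) (fps_scale c)
    (fps_scale_monoid_morphism c).

Lemma fps_scaleC (A : comUnitRingType) (c a : A) :
  fps_scale c (fpsC a) = fpsC a.
Proof. by apply/fpsP => -[|n] /=; rewrite ?mul1r ?mulr0. Qed.

Lemma fps_scaleX (A : comUnitRingType) (c : A) :
  fps_scale c (fpsX A) = fpsC c * fpsX A.
Proof. by apply/fpsP => -[|[|n]]; rewrite fps_coefCM /= ?mulr0 ?mulr1. Qed.

(** * The exponential of power series *)

Lemma fps_exp_scale (A : comUnitRingType) (c : A) (f : fps A) :
  fps_scale c (fps_exp f) = fps_exp (fps_scale c f).
Proof.
apply/fpsP => n /=; rewrite mulr_sumr; apply: eq_bigr => m _.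
by rewrite mulrA -rmorphXn.
Qed.

Lemma fps_exp_map (A B : comUnitRingType) (phi : {rmorphism A -> B})
    (f : fps A) :
    (forall n, n`!%:R \is a @GRing.unit A) ->
  fps_map phi (fps_exp f) = fps_exp (fps_map phi f).
Proof.
move=> uA; apply/fpsP => n /=; rewrite rmorph_sum; apply: eq_bigr => m _.
by rewrite rmorph_div // rmorph_nat -rmorphXn.
Qed.

Lemma fps_exp0 (A : comUnitRingType) : fps_exp (0 : fps A) = 1.
Proof.
apply/fpsP => n /=; rewrite big_ord_recl expr0 divr1 big1 ?addr0 // => i _.
by rewrite expr0n /= mul0r.
Qed.

(** Orders add: in a term f_k g_(i-k) with i < a + b, either k < a or i - k < b. *)
Lemma fps_coefM_low (A : comUnitRingType) (f g : fps A) a b :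
    (forall i, (i < a)%N -> fps_coef f i = 0) ->
    (forall i, (i < b)%N -> fps_coef g i = 0) ->
  forall i, (i < a + b)%N -> fps_coef (f * g) i = 0.
Proof.
move=> f0 g0 i lti; rewrite fps_coefM big1 // => k _.
have [/f0 ->|leak] := ltnP k a; first by rewrite mul0r.
by rewrite g0 ?mulr0 // ltn_subLR ?(leq_trans lti) ?leq_add2r // -ltnS.
Qed.

Lemma fps_coefX_low (A : comUnitRingType) (f : fps A) m :
  fps_coef f 0 = 0 -> forall i, (i < m)%N -> fps_coef (f ^+ m) i = 0.
Proof.
move=> f0; elim: m => // m IH i; rewrite exprS.
by apply: (fps_coefM_low (a := 1) _ IH) => -[].
Qed.

(** The cut-off in [fps_exp] moves with the degree. A common bound [N] turns all lower coefficients
    into those of one finite sum in the ring of series, where ring identities apply. *)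
Lemma fps_exp_trunc (A : comUnitRingType) (f : fps A) n N :
    fps_coef f 0 = 0 -> (n < N)%N ->
  fps_coef (fps_exp f) n =
  fps_coef (\sum_(m < N) fpsC (m`!%:R^-1) * f ^+ m) n.
Proof.
move=> f0 ltnN; rewrite fps_coef_sum [LHS]/=.
rewrite (big_ord_widen N (fun m => fps_coef (f ^+ m) n / m`!%:R)) //.
under [RHS]eq_bigr do rewrite fps_coefCM mulrC.
(* The terms with n < m < N vanish, since f^m starts at degree m. *)
rewrite [RHS](bigID (fun m : 'I_N => (m < n.+1)%N)) /= [X in _ + X]big1 ?addr0 //.
by move=> m; rewrite -leqNgt => ltnm; rewrite fps_coefX_low ?mul0r.
Qed.

(** In degree n, both sides are the sum of f^a g^b / (a! b!) over a + b <= n: the left by the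
    binomial theorem with m = a + b, the right by multiplying truncated exponentials and dropping
    the terms of too high order. *)
Lemma fps_expD (A : comUnitRingType) (f g : fps A) :
    (forall n, n`!%:R \is a @GRing.unit A) ->
    fps_coef f 0 = 0 -> fps_coef g 0 = 0 ->
  fps_exp (f + g) = fps_exp f * fps_exp g.
Proof.
move=> uA f0 g0; apply/fpsP => n.
pose c a b := fps_coef (fpsC ((a`! * b`!)%:R^-1) * (f ^+ a * g ^+ b)) n.
transitivity (\sum_(a < n.+1) \sum_(b < n.+1 | (a + b < n.+1)%N) c a b).
  rewrite (@fps_exp_trunc _ _ _ n.+1) //=; last by rewrite f0 g0 addr0.
  rewrite fps_coef_sum.
  transitivity (\sum_(m < n.+1) \sum_(a < n.+1 | (a <= m)%N) c a (m - a)%N).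
    apply: eq_bigr => m _; rewrite addrC exprDn mulr_sumr fps_coef_sum.
    pose d a :=
      fps_coef (fpsC (m`!%:R^-1) * (g ^+ (m - a) * f ^+ a *+ 'C(m, a))) n.
    rewrite (big_ord_widen n.+1 d) //; apply: eq_big => // a.
    rewrite ltnS /d => leam; rewrite /c !fps_coefCM [g ^+ _ * _]mulrC fps_coefMn.
    rewrite -[_ *+ 'C(m, a)]mulr_natl mulrA; congr (_ * _).
    (* As a factor of the unit m!, the binomial coefficient is a unit too, and ['C(m, a)] / m! = 1 /
       (a! (m - a)!). *)
    have /(congr1 (fun k => k%:R : A)) := bin_fact leam.
    rewrite natrM => facm; have ubin : 'C(m, a)%:R \is a @GRing.unit A.
      by have := uA m; rewrite -facm unitrM => /andP[].
    by rewrite -facm invrM ?mulrVK // natrM unitrM !uA.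
  (* Exchange the sums and reindex by b = m - a, which turns m <= n into a + b <= n. *)
  rewrite (exchange_big_dep predT) //=; apply: eq_bigr => a _.
  rewrite -(big_mkord (fun m => (a <= m)%N) (fun m => c a (m - a)%N)).
  rewrite -(big_nat_widenl _ _ _ predT) // -{1}[a : nat]add0n big_addn big_mkord.
  rewrite (big_ord_widen _ (fun b => c a (b + a - a)%N) (leq_subr a n.+1)).
  by apply: eq_big => [b|b _]; rewrite ?addnK // ltn_subRL.
(* Only degrees at most n of each factor matter, and there truncation after m = n is exact. *)
have -> : fps_coef (fps_exp f * fps_exp g) n =
    fps_coef ((\sum_(m < n.+1) fpsC (m`!%:R^-1) * f ^+ m) *
              (\sum_(m < n.+1) fpsC (m`!%:R^-1) * g ^+ m)) n.
  rewrite !fps_coefM; apply: eq_bigr => i _.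
  by rewrite -!fps_exp_trunc // ltnS leq_subr.
rewrite big_distrlr fps_coef_sum; apply: eq_bigr => a _.
rewrite fps_coef_sum big_mkcond; apply: eq_bigr => b _.
rewrite /c natrM invrM ?uA // [X in _ = fps_coef X _]mulrACA -rmorphM [b`!%:R^-1 * _]mulrC !fps_coefCM.
(* If a + b > n, then f^a g^b has no term of degree n. *)
have [//|leab] := ltnP.
by rewrite (fps_coefM_low (a := a) (b := b)) ?mulr0 // => i; exact: fps_coefX_low.
Qed.

Lemma fps_expMn (A : comUnitRingType) (f : fps A) j :
    (forall n, n`!%:R \is a @GRing.unit A) -> fps_coef f 0 = 0 ->
  fps_exp (f *+ j) = fps_exp f ^+ j.
Proof.
move=> uA f0; elim: j => [|j IH]; first exact: fps_exp0.
by rewrite mulrS exprS fps_expD ?IH // fps_coefMn f0 mul0rn.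
Qed.

(** * Identities between the generating functions *)

(* Stated abstractly, so that unification does not unfold power series. *)
Lemma rmorph_divXK (A B : comUnitRingType) (phi : {rmorphism A -> B}) r
    (a u c : A) :
  u \is a GRing.unit ->
  phi ((a / u) ^+ r * c) * phi u ^+ r = phi a ^+ r * phi c.
Proof.
by move=> uu; rewrite rmorphM mulrAC rmorphXn -exprMn -rmorphM mulrVK.
Qed.

(** Substituting 2t is a ring morphism, so the denominator can be cancelled before the morphism is
    applied; no inverse has to be carried through the substitution. *)
Lemma frobenius_euler_scale2 (F : numFieldType) (r : nat) (lambda : F) :
    lambda != 1 ->
  fps_scale 2 (frobenius_euler_gf r lambda) *
    (fps_exp (fpsX {poly F} *+ 2) - fpsC lambda%:P) ^+ r =
  fpsC (1 - lambda)%:P ^+ r * fps_exp (fpsC ('X *+ 2) * fpsX _).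
Proof.
move=> l1; have uE := exp_sub_unit l1.
have scaleX2 : fps_scale 2 (fpsX {poly F}) = fpsX _ *+ 2.
  by rewrite fps_scaleX (rmorph_nat (@fpsC _)) mulr_natl.
have scaleE : fps_scale 2 (fps_exp (fpsX {poly F}) - fpsC lambda%:P) =
    fps_exp (fpsX _ *+ 2) - fpsC lambda%:P.
  by rewrite rmorphB /= fps_scaleC fps_exp_scale scaleX2.
have scaleexpx : fps_scale 2 (fps_exp (fpsC 'X * fpsX {poly F})) =
    fps_exp (fpsC ('X *+ 2) * fpsX _).
  rewrite fps_exp_scale rmorphM /= fps_scaleC fps_scaleX mulrA -rmorphM.
  by rewrite mulr_natr.
have := rmorph_divXK (fps_scale 2) r (fpsC (1 - lambda)%:P)
  (fps_exp (fpsC 'X * fpsX _)) uE.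
by rewrite /= scaleE scaleexpx fps_scaleC.
Qed.

Lemma hermite_gf_horner (F : numFieldType) (a : F) n :
  fps_coef (fps_map (polyC \o horner_eval a) (hermite_gf F)) n *+ n`! =
  (hermite F n).[a]%:P.
Proof. by rewrite /hermite hornerMn polyCMn. Qed.

Lemma fps_coef0_oppX2 (A : comUnitRingType) : fps_coef (- fpsX A ^+ 2) 0 = 0.
Proof. by rewrite /= big_ord1 mul0r oppr0. Qed.

(** At x = j the series e^{2jt - t^2} contains the j-th power of e^{2t}, the shape of the terms in
    the binomial expansion of (e^{2t} - lambda)^r. *)
Lemma hermite_gf_horner_nat (F : numFieldType) (j : nat) :
  fps_map (polyC \o horner_eval j%:R) (hermite_gf F) =
  fps_exp (fpsX _ *+ 2) ^+ j * fps_exp (- fpsX _ ^+ 2).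
Proof.
rewrite /hermite_gf (fps_exp_map (polyC \o horner_eval j%:R)); last first.
  exact: fact_poly_unit.
have uF := @fact_poly_unit F.
rewrite rmorphB rmorphM rmorphXn /= fps_mapX fps_mapC /=.
rewrite horner_evalE hornerMn hornerX polyCMn polyC_natr.
have -> : fpsC (j%:R *+ 2) * fpsX {poly F} = fpsX _ *+ 2 *+ j.
  by rewrite rmorphMn rmorph_nat -mulrnA mulr_natl -!mulrnA mulnC.
by rewrite -fps_expMn ?fps_expD // ?fps_coef0_oppX2 // !fps_coefMn !mul0rn.
Qed.

Lemma hermite_gfE_frobenius_euler (F : numFieldType) (r : nat) (lambda : F) :
    lambda != 1 ->
  fpsC (1 - lambda)%:P ^+ r * hermite_gf F =
  fps_scale 2 (frobenius_euler_gf r lambda) *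
    \sum_(j < r.+1) fpsC ('C(r, j)%:R * (- lambda) ^+ (r - j))%:P *
      fps_map (polyC \o horner_eval j%:R) (hermite_gf F).
Proof.
move=> l1; have uF := @fact_poly_unit F.
rewrite [in LHS](_ : hermite_gf F =
    fps_exp (fpsC ('X *+ 2) * fpsX _) * fps_exp (- fpsX _ ^+ 2)); last first.
  by rewrite -fps_expD // ?fps_coef0_oppX2 // fps_coefCM mulr0.
rewrite mulrA -frobenius_euler_scale2 // -mulrA; congr (_ * _).
(* [exprDn] puts the exponent r - j on the first summand, so -lambda is moved to the front. *)
rewrite [_ - _]addrC exprDn mulr_suml; apply: eq_bigr => j _.
rewrite hermite_gf_horner_nat mulrA; congr (_ * _).
rewrite -rmorphN -polyCN -rmorphXn -polyC_exp polyCM rmorphM polyC_natr rmorph_nat.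
by rewrite -mulrA mulr_natl.
Qed.

(** * Comparison of coefficients *)

Lemma hermite_frobenius_euler (F : numFieldType) (r : nat) (lambda : F) (n : nat) :
    lambda != 1 ->
  hermite F n =
    ((1 - lambda) ^+ r)^-1 *:
      \sum_(0 <= k < n.+1)
        (('C(n, k)%:R * 2 ^+ k *
          (\sum_(0 <= j < r.+1)
             'C(r, j)%:R * (- lambda) ^+ (r - j) *
             (hermite F (n - k)).[j%:R]))
         *: frobenius_euler r lambda k).
Proof.
move=> l1.
have l1r : (1 - lambda) ^+ r != 0 by rewrite expf_neq0 // subr_eq0 eq_sym.
apply: (scalerI l1r); rewrite scalerA mulfV // scale1r big_mkord.
have /(congr1 (fun f => fps_coef f n *+ n`!)) := hermite_gfE_frobenius_euler r l1.
rewrite -rmorphXn fps_coefCM -polyC_exp mul_polyC -scalerMnr => ->.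
rewrite fps_coefM -sumrMnl; apply: eq_bigr => k _.
set T := fps_coef (\sum_(j < _) _) _; set S := \sum_(0 <= j < _) _.
(* The inner sum consists of values of Hermite polynomials, hence enters the series as a constant
   polynomial. *)
have TS : T *+ (n - k)`! = S%:P.
  rewrite /T /S fps_coef_sum big_mkord -sumrMnl rmorph_sum; apply: eq_bigr => j _.
  by rewrite fps_coefCM -mulrnAr hermite_gf_horner -polyCM.
have lekn : (k <= n)%N by rewrite -ltnS.
(* Split n! as ['C(n, k)] k! (n - k)!: the factor (n - k)! goes to [T], and k! to the
   Frobenius-Euler coefficient. The power 2^k comes from [fps_scale]. *)
rewrite /frobenius_euler -(bin_fact lekn) mulnA mulnC mulrnA -mulrnAr TS.
rewrite -scalerMnr mulrnA; congr (_ *+ _).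
rewrite -mul_polyC !polyCM polyC_exp !polyC_natr -[LHS]mulr_natl -!mulrA.
by rewrite [S%:P * _]mulrC.
Qed.

Theorem theorem8 (R : realType) (r : nat) (lambda : R[i])
    (hlambda : lambda <> 1) (n : nat) :
  hermite R[i] n =
    ((1 - lambda) ^+ r)^-1 *:
      \sum_(0 <= k < n.+1)
        (('C(n, k)%:R * 2 ^+ k *
          (\sum_(0 <= j < r.+1)
             'C(r, j)%:R * (- lambda) ^+ (r - j) *
             (hermite R[i] (n - k)).[j%:R]))
         *: frobenius_euler r lambda k).
Proof. exact/hermite_frobenius_euler/eqP. Qed.
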